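(* Let $\kappa$ be an uncountable cardinal. If there is a cofinal Kurepa family in $[\kappa]^\omega$, then $\mathfrak{par}(\kappa^\omega) = \mathrm{cf}[\kappa]^\omega$.
   Context: The cardinal $\kappa$ has the discrete topology and $\kappa^\omega$ the product topology. For a topological space $X$, $\mathfrak{par}(X) = \min\{|\mathcal{P}| : \mathcal{P} \text{ is a partition of } X \text{ into Polish subspaces}\}$. $[A]^\omega$ denotes the set of countably infinite subsets of $A$. A family $\mathcal{F} \subseteq [A]^\omega$ is cofinal in $[A]^\omega$ if for every $X \in [A]^\omega$ there is $Y \in \mathcal{F}$ with $Y \supseteq X$; it is Kurepa if $\{X \cap Y : Y \in \mathcal{F}\}$ is countable for every countable set $X$; a cofinal Kurepa family is one that is both. $\mathrm{cf}[A]^\omega = \min\{|\mathcal{F}| : \mathcal{F} \text{ cofinal in } [A]^\omega\}$. *)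

(* Defs.v *)
From HB Require Import structures.
From mathcomp Require Import all_boot all_order all_algebra.
From mathcomp Require Import all_classical all_reals all_analysis.

Set Implicit Arguments.
Unset Strict Implicit.
Unset Printing Implicit Defensive.

Local Open Scope classical_set_scope.
Local Open Scope card_scope.

Definition separable_space (X : topologicalType) : Prop :=
  exists2 D : set X, countable D & dense D.

Definition complete_metric (R : realType) (M : metricType R) : Prop :=
  forall u : nat -> M, cauchy (u @ \oo) -> exists l : M, u @ \oo --> l.

Definition homeomorphic (X Y : topologicalType) : Prop :=
  exists (f : X -> Y) (g : Y -> X),
    [/\ cancel f g, cancel g f, continuous f & continuous g].

Definition completely_metrizable (R : realType) (X : topologicalType) : Prop :=
  exists2 M : metricType R, complete_metric M & homeomorphic X M.

Definition polish (R : realType) (X : topologicalType) : Prop :=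
  separable_space X /\ completely_metrizable R X.

(* The coercion of [A] to the type [set_type A] carries the subspace topology;
   the library's [subspace A] does not, its carrier being all of [X]. *)
Definition polish_partition (R : realType) (X : topologicalType)
    (P : set (set X)) : Prop :=
  partition P id [set: X] /\ forall A : set X, P A -> polish R A.

(* A cardinal of the form min {|F| : F in C} is represented by any [F] in [C]
   attaining the minimum; two such [F] are equinumerous. *)
Definition attains_min_card (T : Type) (C : set (set T)) (F : set T) : Prop :=
  C F /\ forall G : set T, C G -> F #<= G.

Definition attains_par (R : realType) (X : topologicalType)
    (P : set (set X)) : Prop :=
  attains_min_card [set Q | polish_partition R Q] P.

Definition ctbl_infinite_subsets (T : Type) (A : set T) : set (set T) :=
  [set X | [/\ X `<=` A, countable X & infinite_set X]].

Definition cofinal_family (T : Type) (A : set T) (F : set (set T)) : Prop :=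
  F `<=` ctbl_infinite_subsets A /\
  forall X, ctbl_infinite_subsets A X -> exists2 Y, F Y & X `<=` Y.

Definition kurepa_family (T : Type) (A : set T) (F : set (set T)) : Prop :=
  F `<=` ctbl_infinite_subsets A /\
  forall X : set T, countable X -> countable [set X `&` Y | Y in F].

Definition attains_cf (T : Type) (A : set T) (F : set (set T)) : Prop :=
  attains_min_card [set G | cofinal_family A G] F.

Definition omega_power (K : choiceType) : topologicalType :=
  {ptws nat -> discrete_topology K}.

(* Main.v *)
(** Every piece of a Polish partition of [K ^ω] is separable, so the values
    taken by its points form a countable set; these countable sets are cofinal
    because each countable subset of [K] is the range of some point. Hence
    [par (K ^ω) >= cf]. Conversely, well-order a cofinal Kurepa family of
    minimal size and let the piece of [Y] be [Y ^ω] minus the [Y' ^ω] for the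
    earlier [Y']. Only the traces [Y' ∩ Y] matter here, and by the Kurepa
    property they are countably many, so the piece is a G_delta in the Polish
    space [Y ^ω]. *)

From HB Require Import structures.
Require Import Defs.
From mathcomp Require Import all_boot all_order all_algebra.
From mathcomp Require Import all_classical all_reals all_analysis.
From mathcomp Require Import wochoice.
Import Order.TTheory GRing.Theory Num.Theory.

Local Open Scope classical_set_scope.
Local Open Scope card_scope.

(* A maximal set of pairwise everywhere-different choice functions on [C] must
   be mapped onto some [F] in [C] by evaluation at [F], and injects into every
   member of [C]. *)
Lemma attains_min_card_exists (T : Type) (C : set (set T)) :
  C !=set0 -> exists F, attains_min_card C F.
Proof.
move=> [G0 CG0].
have [C0|C0] := pselect (C set0).
  by exists set0; split=> // G _; exact: card_ge0.
have Cn0 G : C G -> G !=set0.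
  by move=> CG; apply/set0P/eqP => G0E; apply: C0; rewrite -G0E.
pose P (S : set (set T -> T)) :=
  (forall f, S f -> forall G, C G -> G (f G)) /\
  (forall f g, S f -> S g -> forall G, C G -> f G = g G -> f = g).
have [|S [[SC Sinj] Smax]] := @Zorn_bigcup _ P.
  move=> FF FFP tot; split=> [f [S FS Sf]|f g [S FS Sf] [S' FS' Sg]].
    exact: (FFP _ FS).1.
  by have [le|le] := tot _ _ FS FS'; [apply: (FFP _ FS').2 => //; exact: le|
     apply: (FFP _ FS).2 => //; exact: le].
have [F CF FS] : exists2 F, C F & F `<=` [set f F | f in S].
  (* Otherwise [h] picks in each member of [C] a point that no function of [S] takes there, and
     adding [h] to [S] contradicts maximality. *)
  apply: contrapT => noF.
  have ex G : exists y, C G -> G y /\ ~ [set f G | f in S] y.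
    have [CG|nCG] := pselect (C G); last first.
      by have [y _] := Cn0 _ CG0; exists y.
    apply: contrapT => noy; apply: noF; exists G => // y Gy.
    by apply: contrapT => Sy; apply: noy; exists y.
  have [h hP] := choice ex.
  have Sh f G : C G -> S f -> f G <> h G.
    by move=> CG Sf fh; apply: (hP _ CG).2; exists f.
  apply: (Smax (S `|` [set h])); last split.
  - split=> [|sub]; first exact: subsetUl.
    exact: (Sh h G0 CG0 (sub h (or_intror erefl)) erefl).
  - by move=> f [/SC//|->] G /hP[].
  - move=> f g [Sf|->] [Sg|->] G CG //; first exact: Sinj.
      by move=> /(Sh f G CG Sf).
    by move=> /esym/(Sh g G CG Sg).
exists F; split=> // G CG.
apply: card_le_trans (subset_card_le FS) _.
apply: card_le_trans (card_image_le _ _) _.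
apply: (@card_le_trans _ _ _ [set f G | f in S]); last first.
  by apply: subset_card_le => _ [f Sf <-]; exact: (SC f Sf G CG).
have : [set f G | f in S] #= S.
  apply: inj_card_eq => f g /set_mem Sf /set_mem Sg; exact: Sinj.
by rewrite card_eq_le => /andP[].
Qed.

(** * Complete metrics from codes in a sequence space *)

Lemma near_forall_ltn {T : Type} {F : set_system T} {FF : Filter F}
    {P : nat -> T -> Prop} (n : nat) :
  (forall k, \forall i \near F, P k i) ->
  \forall i \near F, forall k, (k < n)%N -> P k i.
Proof.
move=> PF; elim: n => [|n IHn]; first exact: nearW.
near=> i => k; rewrite ltnS leq_eqVlt => /orP[/eqP->|].
  by near: i; exact: PF.
by move: k; near: i.
Unshelve. all: by end_near. Qed.

(** A copy of [T] with [phi_inj] in its type: the metric attached to it cannot clash with a topology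
    that [T] already carries. *)
Definition code_metric (R : realType) (T : choiceType) (D : eqType)
  (phi : T -> nat -> D) (phi_inj : injective phi) : Type := T.

Section code_metric.
Local Open Scope ring_scope.
Context {R : realType} {T : choiceType} {D : eqType}.
Variables (phi : T -> nat -> D) (phi_inj : injective phi).

(** The first-difference metric of [D ^ω], pulled back along [phi]. *)
Definition code_dist (x y : T) : R :=
  if pselect (exists n, phi x n != phi y n) is left h
  then (ex_minn h).+1%:R^-1 else 0.

Variant code_dist_spec (x y : T) : R -> Prop :=
  | CodeDistEq of x = y : code_dist_spec x y 0
  | CodeDistNeq n of phi x n <> phi y n
    & (forall k, (k < n)%N -> phi x k = phi y k) :
      code_dist_spec x y n.+1%:R^-1.

Lemma code_distP x y : code_dist_spec x y (code_dist x y).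
Proof.
rewrite /code_dist; case: pselect => [h|h].
  case: ex_minnP => n /eqP nE nmin; apply: CodeDistNeq => // k kn.
  by apply/eqP; apply: contraTT kn => /nmin; rewrite -leqNgt.
apply: CodeDistEq; apply: phi_inj; apply/funext => n.
by apply/eqP; apply: contrapT => /negP nE; apply: h; exists n.
Qed.

Lemma code_dist_le x y n :
  code_dist x y <= n.+1%:R^-1 <-> forall k, (k < n)%N -> phi x k = phi y k.
Proof.
case: code_distP => [->|m mE meq]; first by split=> // _; rewrite invr_ge0.
rewrite lef_pV2 ?posrE ?ltr0n// ler_nat ltnS; split=> [nm k kn|eqn].
  by apply: meq; exact: leq_trans kn nm.
by rewrite leqNgt; apply/negP => /eqn.
Qed.

Lemma code_dist_ge x y n : phi x n <> phi y n -> n.+1%:R^-1 <= code_dist x y.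
Proof.
case: code_distP => [->//|m mE meq] nE.
rewrite lef_pV2 ?posrE ?ltr0n// ler_nat ltnS leqNgt.
by apply/negP => /meq.
Qed.

Lemma code_dist_ge0 x y : 0 <= code_dist x y.
Proof. by case: code_distP => [//|n _ _]; rewrite invr_ge0. Qed.

Lemma code_distxx x : code_dist x x = 0.
Proof. by case: code_distP => // n /(_ erefl). Qed.

Lemma code_dist_eq0 x y : code_dist x y = 0 -> x = y.
Proof. by case: code_distP => [//|n _ _] /eqP; rewrite invr_eq0 pnatr_eq0. Qed.

Lemma code_dist_sym x y : code_dist x y = code_dist y x.
Proof.
apply/eqP; rewrite eq_le; apply/andP; split.
  case: (code_distP x y) => [_|n nE _]; first exact: code_dist_ge0.
  by apply: code_dist_ge => /esym.
case: (code_distP y x) => [_|n nE _]; first exact: code_dist_ge0.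
by apply: code_dist_ge => /esym.
Qed.

(** Where the codes of [x] and [z] first differ, the code of [y] differs from one of them, so one
    summand is already large enough. *)
Lemma code_dist_triangle y x z :
  code_dist x z <= code_dist x y + code_dist y z.
Proof.
case: (code_distP x z) => [_|n nE _]; first by rewrite addr_ge0 ?code_dist_ge0.
have [xy|xy] := eqVneq (phi x n) (phi y n).
  by rewrite ler_wpDl ?code_dist_ge0// code_dist_ge// -xy.
by rewrite ler_wpDr ?code_dist_ge0// code_dist_ge//; exact/eqP.
Qed.

HB.instance Definition _ := Choice.on (code_metric R T D phi phi_inj).
HB.instance Definition _ := isMetric.Build R (code_metric R T D phi phi_inj)
  code_distxx code_dist_eq0 code_dist_sym code_dist_triangle.

Local Notation M := (code_metric R T D phi phi_inj).

Lemma nbhs_code_metric (x : M) (U : set M) :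
  nbhs x U <->
  exists n, [set y | forall k, (k < n)%N -> phi x k = phi y k] `<=` U.
Proof.
split=> [/nbhs_ballP[e e0 eU]|[n nU]].
  exists (Num.truncn e^-1).+1 => y /= /code_dist_le xy; apply: eU.
  rewrite ballEmdist /=; apply: le_lt_trans xy _.
  rewrite -[ltRHS]invrK ltf_pV2 ?posrE ?invr_gt0 ?ltr0n//.
  by apply: lt_trans (truncnS_gt _) _; rewrite ltr_nat.
apply/nbhs_ballP; exists n.+1%:R^-1 => //=.
by move=> y; rewrite ballEmdist /= => /ltW /code_dist_le /nU.
Qed.

Lemma code_metric_cauchy (u : nat -> M) : cauchy (u @ \oo) ->
  forall n, exists N, forall i, (N <= i)%N -> phi (u i) n = phi (u N) n.
Proof.
move=> /cauchy_ballP; rewrite /cauchy_ball => cu n.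
(* Distance at most [1 / (n + 2)] forces agreement below [n + 1], hence at [n]. *)
have /cu : 0 < n.+2%:R^-1 :> R by rewrite invr_gt0.
rewrite near_simpl => -[[A B]] /= [[N1 _ A1] [N2 _ B2]] AB.
exists (maxn N1 N2) => i Ni.
have /AB /= : (A `*` B) (i, maxn N1 N2).
  split; first by apply: A1 => /=; exact: leq_trans (leq_maxl _ _) Ni.
  by apply: B2 => /=; exact: leq_maxr.
by rewrite ballEmdist /= => /ltW/code_dist_le; exact.
Qed.

End code_metric.

(** The hypotheses make [phi] a homeomorphism onto a closed subset of [D ^ω], with [D] discrete; the
    last one is closedness of the image. *)
Lemma completely_metrizable_code (R : realType) (X : topologicalType)
    (D : eqType) (phi : X -> nat -> D) :
  injective phi ->
  (forall x n, \forall y \near x, phi y n = phi x n) ->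
  (forall x U, nbhs x U ->
    exists n, [set y | forall k, (k < n)%N -> phi x k = phi y k] `<=` U) ->
  (forall u : nat -> X,
    (forall n, exists N, forall i, (N <= i)%N -> phi (u i) n = phi (u N) n) ->
    exists x, forall n, \forall i \near \oo, phi (u i) n = phi x n) ->
  completely_metrizable R X.
Proof.
move=> phi_inj phi_cont phi_base phi_complete.
exists (code_metric R X D phi phi_inj).
  move=> u /code_metric_cauchy/phi_complete[x ux]; exists x => U.
  move=> /nbhs_code_metric[n nU]; rewrite nbhs_simpl /=.
  by apply: filterS (near_forall_ltn n ux) => i xi; apply: nU => k /xi.
exists (idfun : X -> code_metric R X D phi phi_inj), idfun; split=> //.
  move=> x U /nbhs_code_metric[n nU]; rewrite nbhs_simpl /=.
  apply: filterS (near_forall_ltn n (phi_cont x)) => y xy.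
  by apply: nU => k /xy.
move=> x U /phi_base[n nU]; apply/nbhs_code_metric; exists n.
exact: nU.
Qed.

(** * Neighbourhoods in [K ^ω] and in its subspaces *)

Lemma near_omega_power_coord (K : choiceType) (x : omega_power K) n :
  \forall y \near x, y n = x n.
Proof.
have := @proj_continuous nat (fun=> discrete_topology K) n x.
move=> /(_ [set x n]); apply.
by rewrite nbhs_principalE; exact/principal_filterP.
Qed.

(** If no cylinder around [x] fits in [U], points outside [U] that agree with [x] on longer and
    longer initial segments converge to [x], which is absurd. *)
Lemma omega_power_nbhs (K : choiceType) (x : omega_power K)
    (U : set (omega_power K)) :
  nbhs x U -> exists n, [set y | forall k, (k < n)%N -> x k = y k] `<=` U.
Proof.
move=> xU; apply: contrapT => noU.
have ex n : exists y : omega_power K,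
    (forall k, (k < n)%N -> x k = y k) /\ ~ U y.
  apply: contrapT => noy; apply: noU; exists n => y /= xy.
  by apply: contrapT => Uy; apply: noy; exists y.
have [u uP] := choice ex.
have ux : u @ \oo --> x.
  apply/(@pointwise_cvgP nat (discrete_topology K) (u @ \oo) x) => t V.
  rewrite nbhs_principalE => /principal_filterP Vt.
  exists t.+1 => //= i ti; rewrite /= -(uP i).1//.
have [N _ NU] := ux _ xU.
exact: ((uP N).2 (NU N (leqnn N))).
Qed.

Lemma nbhs_set_type (X : topologicalType) (A : set X) (x : A) (U : set A) :
  nbhs x U <-> exists2 V, nbhs (set_val x) V & set_val @^-1` V `<=` U.
Proof.
split=> [|[V xV VU]]; last first.
  apply: filterS VU _; exact: (@initial_continuous A X set_val x V xV).
move=> [_ [[W oW <-] /= Wx WU]]; exists W => //; exact: open_nbhs_nbhs.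
Qed.

(** * The pieces are Polish *)

Section omega_power_Gdelta.
Context {K : choiceType} (Y : set K) (B : nat -> set K).

(** This is [Y ^ω] with the closed sets [B j ^ω] deleted. *)
Definition omega_power_Gdelta : set (omega_power K) :=
  [set x | (forall n, Y (x n)) /\ forall j, exists k, ~ B j (x k)].

Local Notation Z := omega_power_Gdelta.

Lemma near_Gdelta_coord (x : Z) n :
  \forall y \near x, set_val y n = set_val x n.
Proof.
apply/nbhs_set_type; exists [set y | y n = set_val x n] => //.
exact: near_omega_power_coord.
Qed.

Lemma Gdelta_nbhs (x : Z) (U : set Z) : nbhs x U ->
  exists n, [set y | forall k, (k < n)%N -> set_val x k = set_val y k] `<=` U.
Proof.
move=> /nbhs_set_type[V /omega_power_nbhs[n nV] VU]; exists n => y xy.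
exact/VU/nV.
Qed.

Lemma separable_Gdelta : countable Y -> separable_space Z.
Proof.
move=> /countable_injP[e e_inj].
have [[z0 _]|Z0] := pselect ([set: Z] !=set0); last first.
  by exists set0 => // O [x Ox]; exfalso; apply: Z0; exists x.
(* One point is picked in each cylinder that meets [Z]. Through [e] the cylinders are indexed by the
   countable type [seq nat]; [z0] is a default for those that miss [Z]. *)
pose pick (s : seq nat) : Z :=
  xget z0 [set x : Z | forall k, (k < size s)%N -> e (set_val x k) = nth 0 s k].
exists (range pick).
  exact: sub_countable (card_image_le _ _) (countableP _).
move=> O [x Ox] oO.
have [n nO] := Gdelta_nbhs x O (open_nbhs_nbhs (conj oO Ox)).
have ZY (z : Z) k : Y (set_val z k) by have [+ _] := set_valP z; exact.
pose s := mkseq (fun k => e (set_val x k)) n.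
exists (pick s); split; last by exists s.
apply: nO => k kn; apply: e_inj; rewrite ?inE//.
rewrite /pick; case: xgetP => [z _ /(_ k)|/(_ x)].
  by rewrite size_mkseq => /(_ kn) ->; rewrite nth_mkseq.
by case=> i; rewrite size_mkseq => ik; rewrite nth_mkseq.
Qed.

Let leaves (x : Z) j : exists k, `[< ~ B j (set_val x k) >].
Proof.
have [_ /(_ j)[k kB]] := set_valP x.
by exists k; exact/asboolP.
Qed.

(* The second component remembers when [x] leaves [B j]: it keeps a Cauchy
   sequence from converging to a point of the deleted set [B j ^ω]. *)
Definition Gdelta_code (x : Z) (j : nat) : K * nat :=
  (set_val x j, ex_minn (leaves x j)).

(** The first exit from [B j] is decided by the coordinates up to it. Hence it is locally constant,
    and it stabilizes along sequences converging in [Z]. *)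
Lemma Gdelta_code_exit (x y : Z) j (k := ex_minn (leaves x j)) :
  (forall i, (i <= k)%N -> set_val y i = set_val x i) ->
  ex_minn (leaves y j) = k.
Proof.
rewrite {}/k; case: ex_minnP => k kB kmin xy.
case: ex_minnP => l lB lmin; apply/eqP; rewrite eqn_leq.
have lk : (l <= k)%N by apply: lmin; rewrite xy.
by rewrite lk kmin// -xy.
Qed.

Lemma Gdelta_code_inj : injective Gdelta_code.
Proof.
move=> x y /funeqP xy; apply: val_inj; apply/funext => n.
by have [] := xy n.
Qed.

Lemma completely_metrizable_Gdelta (R : realType) : completely_metrizable R Z.
Proof.
apply: (completely_metrizable_code R Z _ _ Gdelta_code_inj).
- move=> x j; near=> y; congr (_, _).
    by near: y; exact: near_Gdelta_coord.
  apply: Gdelta_code_exit; near: y.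
  exact: (near_forall_ltn (ex_minn _).+1 (near_Gdelta_coord x)).
- move=> x U /Gdelta_nbhs[n nU]; exists n => y /= xy; apply: nU => k /xy.
  by case.
- move=> u uP; have [N NP] := choice uP.
  pose x : omega_power K := fun n => (Gdelta_code (u (N n)) n).1.
  have ux n i : (N n <= i)%N -> set_val (u i) n = x n.
    by move=> /NP e; rewrite /x -e.
  have Zx : Z x.
    split=> [n|j].
      have [+ _] := set_valP (u (N n)); exact.
    exists (Gdelta_code (u (N j)) j).2.
    set k := _.2.
    (* At index [i] both the exit from [B j] and coordinate [k] have their final values, so [x k]
       lies outside [B j]. *)
    pose i := maxn (N j) (N k).
    rewrite -(ux k i) ?leq_maxr//.
    have : (Gdelta_code (u i) j).2 = k by rewrite NP// leq_maxl.
    rewrite /Gdelta_code /=; case: ex_minnP => m /asboolP mB _ <-; exact: mB.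
  have uxn n : \forall i \near \oo, set_val (u i) n = x n.
    by exists (N n) => // i; exact: ux.
  exists (SigSub (mem_set Zx)) => n; near=> i; congr (_, _).
    by near: i; exact: uxn.
  apply: Gdelta_code_exit; near: i.
  exact: (near_forall_ltn (ex_minn _).+1 uxn).
Unshelve. all: by end_near. Qed.
End omega_power_Gdelta.

Lemma countableU (T : Type) (A B : set T) :
  countable A -> countable B -> countable (A `|` B).
Proof.
move=> cA cB; rewrite -bigcup2E; apply: bigcup_countable => // -[|[|n]] _ //=.
Qed.

Lemma polish_omega_power_diff (R : realType) (K : choiceType) (Y : set K)
    (BB : set (set K)) : countable Y -> countable BB ->
  polish R [set x : omega_power K |
    (forall n, Y (x n)) /\ forall C, BB C -> exists k, ~ C (x k)].
Proof.
move=> cY cBB.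
(* Adding [set0] makes the family nonempty, so that [nat] maps onto it; it deletes no point, since
   no sequence has all its values in [set0]. *)
have : BB `|` [set set0] #<= [set: nat].
  exact: countableU.
move=> /pfcard_geP[/seteqP[/(_ set0)]|[B]]; first by case; right.
suff -> : [set x : omega_power K |
    (forall n, Y (x n)) /\ forall C, BB C -> exists k, ~ C (x k)] =
    omega_power_Gdelta Y B.
  split; first exact: separable_Gdelta.
  exact: completely_metrizable_Gdelta.
apply/seteqP; split=> x [xY xB]; split=> //.
  by move=> j; have [/xB//|->] := 'funS_B (I : [set: nat] j); exists 0.
move=> C BC; have [j _ <-] := 'surj_B (or_introl BC : (BB `|` [set set0]) C).
exact: xB.
Qed.

(** * Lower bound: cofinal families from Polish partitions *)

(** Fixing one coordinate is an open condition, so every value taken on [A] at [n] is also taken at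
    [n] by a point of the dense set [D]. *)
Lemma countable_coords (K : choiceType) (A : set (omega_power K)) :
  separable_space A -> countable [set x n | x in A & n in [set: nat]].
Proof.
move=> [D cD dD].
apply: (@sub_countable _ _ _
    (\bigcup_(n in [set: nat]) [set (set_val d : omega_power K) n | d in D])).
  apply: subset_card_le => _ [x Ax [n _ <-]]; exists n => //.
  pose z : A := SigSub (mem_set Ax).
  pose O : set A := set_val @^-1` [set y : omega_power K | y n = x n].
  have [||d [Od Dd]] := dD O; last by exists d.
    by exists z.
  rewrite openE => y /= Oy; apply/nbhs_set_type.
  exists [set w : omega_power K | w n = x n] => //.
  by rewrite -Oy; exact: near_omega_power_coord.
apply: bigcup_countable => // n _.
exact: sub_countable (card_image_le _ _) cD.
Qed.

Lemma countable_infinite_subset (T : Type) (A : set T) : infinite_set A ->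
  exists N, ctbl_infinite_subsets A N.
Proof.
move=> /infiniteP/card_subP[N NE NA]; exists N; split=> //.
  by rewrite (eq_countable NE).
by apply/infiniteP; rewrite (card_le_eqr NE).
Qed.

Lemma cofinal_of_polish_partition (R : realType) (K : choiceType)
    (P : set (set (omega_power K))) :
  infinite_set [set: K] -> polish_partition R P ->
  exists2 F : set (set K), cofinal_family [set: K] F & F #<= P.
Proof.
move=> /countable_infinite_subset[N [_ cN iN]] [[Pcover _ _] Ppolish].
(* The values on a piece may be finite in number; [N] makes the set infinite. *)
pose S (A : set (omega_power K)) := [set x n | x in A & n in [set: nat]] `|` N.
exists (S @` P); last exact: card_image_le.
split=> [_ [A PA <-]|X [_ cX iX]].
  split=> //.
    apply: countableU => //; apply: countable_coords.
    by have [] := Ppolish A PA.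
  by apply: sub_infinite_set iN; exact: subsetUr.
have /pfcard_geP[X0|[x]] := cX; first by exfalso; apply: iX; rewrite X0.
have : [set: omega_power K] (x : nat -> K) by [].
rewrite -Pcover => -[A PA Ax]; exists (S A); first by exists A.
by move=> a /'surj_x[n _ <-]; left; exists (x : nat -> K) => //; exists n.
Qed.

(** * Upper bound: Polish partitions from cofinal Kurepa families *)

(** Choosing a superset in [F] for each member of [G] suffices. This thins a Kurepa family to
    minimal size. *)
Lemma cofinal_subfamily (T : Type) (A : set T) (F G : set (set T)) :
  cofinal_family A F -> cofinal_family A G ->
  exists2 F', F' `<=` F & cofinal_family A F' /\ F' #<= G.
Proof.
move=> [FA Fcof] [GA Gcof].
have ex X : exists Y, G X -> F Y /\ X `<=` Y.
  have [GX|nGX] := pselect (G X); last by exists set0.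
  by have [Y FY XY] := Fcof _ (GA _ GX); exists Y.
have [f fP] := choice ex.
exists (f @` G); first by move=> _ [X /fP[FX _] <-].
split; last exact: card_image_le.
split=> [_ [X /fP[/FA fA _] <-]//|X /Gcof[Y GY XY]].
by exists (f Y); [exists Y|apply: subset_trans XY (fP _ GY).2].
Qed.

Lemma polish_partition_of_kurepa (R : realType) (K : choiceType)
    (F : set (set K)) : infinite_set [set: K] ->
  cofinal_family [set: K] F -> kurepa_family [set: K] F ->
  exists2 P : set (set (omega_power K)), polish_partition R P & P #<= F.
Proof.
move=> /countable_infinite_subset[N [_ cN iN]] [FK Fcof] [_ Fkur].
have [le le_wo] := well_ordering_principle (set K).
pose pow (Y : set K) : set (omega_power K) := [set x | forall n, Y (x n)].
pose lt Y Y' := le Y Y' /\ Y <> Y'.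
have le_min (Q : set (set K)) : Q !=set0 ->
    exists2 Y, Q Y & forall Y', Q Y' -> le Y Y'.
  move=> [Y QY]; have [|Y0 [[Y0Q Y0min] _]] := le_wo (fun X => X \in Q).
    by exists Y; rewrite unfold_in; exact/mem_set.
  exists Y0; first by move: Y0Q; rewrite unfold_in => /set_mem.
  by move=> Y' QY'; apply: Y0min; rewrite unfold_in; exact/mem_set.
have le_anti Y Y' : le Y Y' -> le Y' Y -> Y = Y'.
  move=> YY' Y'Y.
  apply: (@wo_chain_antisymmetric _ le predT) => //; first exact: withinW.
  by rewrite YY' Y'Y.
have le_total Y Y' : le Y Y' \/ le Y' Y.
  have [|Z] := le_min [set Y; Y']; first by exists Y; left.
  by move=> [->|->] min; [left|right]; apply: min; [right|left].
pose piece Y := [set x | pow Y x /\ forall Y', F Y' -> lt Y' Y -> ~ pow Y' x].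
(* A piece is empty when earlier members already cover [pow Y]; a partition admits no empty
   member. *)
exists ((piece @` F) `\ set0); last first.
  exact: card_le_trans (card_le_setD _ _) (card_image_le _ _).
split; first split.
- apply/seteqP; split=> // x _.
  have [|Y [FY xY] Ymin] := le_min [set Y | F Y /\ pow Y x].
    (* The range of [x] may be finite, so [N] is added before cofinality is applied. *)
    have [|Y FY XY] := Fcof (range x `|` N).
      split=> //.
        by apply: countableU => //; exact: sub_countable (card_image_le _ _) _.
      by apply: sub_infinite_set iN; exact: subsetUr.
    by exists Y; split=> // n; apply: XY; left; exists n.
  have px : piece Y x.
    by split=> // Y' FY' [le1 ne] xY'; apply/ne/le_anti => //; exact: Ymin.
  exists (piece Y) => //; split; first by exists Y.
  by move=> /= pE; rewrite pE in px.
- move=> _ _ [[Y FY <-] _] [[Y' FY' <-] _] [x [[xY Ymin] [xY' Y'min]]].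
  have [->//|ne] := pselect (Y = Y'); exfalso.
  (* The later of the two pieces excludes [x], since [x] lies in the power of the earlier set. *)
  have [l|l] := le_total Y Y'; first by apply: (Y'min Y).
  by apply: (Ymin Y') => //; split=> // /esym.
- by move=> A [_ An0]; apply/set0P/eqP.
- move=> _ [[Y FY <-] _].
  pose BB := [set Y `&` Y' | Y' in [set Y' | F Y' /\ lt Y' Y]].
  have cY : countable Y by have [] := FK _ FY.
  have cBB : countable BB.
    apply: sub_countable (Fkur Y cY); apply: subset_card_le.
    by move=> _ [Y' [FY' _] <-]; exists Y'.
  suff -> : piece Y = [set x : omega_power K | (forall n, Y (x n)) /\
      forall C, BB C -> exists k, ~ C (x k)] by exact: polish_omega_power_diff.
  apply/seteqP; split=> x [xY xB]; split=> //.
    move=> _ [Y' [FY' Y'Y] <-]; apply: contrapT => nB.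
    apply: (xB Y' FY' Y'Y) => n; apply: contrapT => nY'.
    by apply: nB; exists n => -[].
  move=> Y' FY' Y'Y xY'; have [|k] := xB (Y `&` Y'); first by exists Y'.
  by apply; split; [exact: xY|exact: xY'].
Qed.

Theorem theorem4p4 (R : realType) (K : choiceType)
    (K_uncountable : ~ countable [set: K])
    (K_kurepa : exists F : set (set K),
        cofinal_family [set: K] F /\ kurepa_family [set: K] F) :
  exists (P : set (set (omega_power K))) (F : set (set K)),
    [/\ attains_par R P, attains_cf [set: K] F & P #= F].
Proof.
have K_infinite : infinite_set [set: K].
  by move=> /finite_set_countable.
have [F0 [F0cof [F0K F0kur]]] := K_kurepa.
have [|F [Fcof Fmin]] :=
    attains_min_card_exists _ [set G | cofinal_family [set: K] G].
  by exists F0.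
(* The Kurepa property passes to subfamilies, so it survives this reduction in size. *)
have [F1 F1F0 [F1cof F1F]] := cofinal_subfamily _ _ _ _ F0cof Fcof.
have F1kur : kurepa_family [set: K] F1.
  split; first exact: F1cof.1.
  move=> X /F0kur; apply: sub_countable; apply: subset_card_le.
  exact: image_subset.
have [P Ppart PF1] := polish_partition_of_kurepa R K F1 K_infinite F1cof F1kur.
have PF : P #<= F := card_le_trans PF1 F1F.
have FQ (Q : set (set (omega_power K))) :
    polish_partition R Q -> F #<= Q.
  move=> Qpart.
  have [G /Fmin FG GQ] := cofinal_of_polish_partition R K Q K_infinite Qpart.
  exact: card_le_trans FG GQ.
exists P, F; split=> //.
  by split=> // Q /FQ; exact: card_le_trans.
exact: Cantor_Bernstein PF (FQ P Ppart).
Qed.
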